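(* For every locally convex space $E$, the space $(E,w)$ is linearly Eberlein-Grothendieck if and only if the dual locally convex space $(E^{\ast}, w^{\ast})$ is compactly generated.
   Context: All topological spaces are assumed to be Tychonoff (in particular locally convex spaces are Hausdorff) and all vector spaces are over $\mathbb{R}$. For a locally convex space $E$, $E^{\ast}$ is the space of continuous linear functionals on $E$, $w=\sigma(E,E^{\ast})$ is the weak topology of $E$, and $w^{\ast}=\sigma(E^{\ast},E)$ is the weak$^{\ast}$ topology on $E^{\ast}$. $C_p(K)$ is the space of continuous real-valued functions on $K$ with the topology of pointwise convergence. A locally convex space $H$ is linearly Eberlein-Grothendieck if $H$ is linearly isomorphic (i.e. linearly homeomorphic) to a linear subspace of $C_p(K)$ for some compact space $K$. A topological vector space $L$ is compactly generated if there is a compact subset $K\subset L$ whose linear span equals $L$. *)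

(* Defs.v *)
From HB Require Import structures.
From mathcomp Require Import all_boot all_order all_algebra.
From mathcomp Require Import all_classical all_reals all_analysis.
From mathcomp Require Import ring.

Set Implicit Arguments.
Unset Strict Implicit.
Unset Printing Implicit Defensive.

Import Order.TTheory GRing.Theory Num.Theory.
Import numFieldNormedType.Exports.

Local Open Scope classical_set_scope.
Local Open Scope ring_scope.

(* A copy of V carrying the coarsest topology that makes every F i continuous;
   a topology that V may already have is ignored. *)
Definition sigma_topology (R : realType) (V : lmodType R) (I : Type)
  (F : I -> {linear V -> R}) : Type := V.

Section SigmaTopology.
Context (R : realType) (V : lmodType R) (I : Type) (F : I -> {linear V -> R}).
Local Notation W := (sigma_topology F).
Let ev : V -> {ptws I -> R} := fun v i => F i v.

HB.instance Definition _ := GRing.Lmodule.copy W V.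
HB.instance Definition _ := Topological.copy W (initial_topology ev).

Lemma sigma_cvgP (G : set_system W) (v : W) : Filter G ->
  (G --> v) <-> (forall i, F i x @[x --> G] --> F i v).
Proof.
move=> FG; split=> [Gv i|Gv].
  have evG : ev @ G --> ev v.
    apply: cvg_trans (@initial_continuous V {ptws I -> R} ev v).
    exact: cvg_app Gv.
  have /cvg_sup/(_ i) evGi : ev @ G --> (ev v : {ptws I -> R}) := evG.
  move=> A; rewrite nbhsE => -[B [oB Bv] BA].
  apply: (evGi ((fun g : I -> R => g i) @^-1` A)).
  rewrite nbhsE; exists ((fun g : I -> R => g i) @^-1` B); last by move=> g /BA.
  by split=> //; exists B.
have evG : ev @ G --> ev v.
  apply/cvg_sup => i A; rewrite nbhsE => -[_ [[B oB <-] Bv] BA].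
  have : nbhs (F i v) B by exact: open_nbhs_nbhs.
  move=> /(Gv i) GB; change (G (ev @^-1` A)).
  apply: (@filterS W G FG _ _ _ GB) => x Bx; exact: BA.
move=> A; rewrite nbhsE => -[_ [[B oB <-] Bv] BA].
have /evG GB : nbhs (ev v : {ptws I -> R}) B by exact: open_nbhs_nbhs.
by apply: (@filterS W G FG _ _ _ GB) => x Bx; exact: BA.
Qed.

Lemma sigma_eval_continuous i : continuous (F i : W -> R).
Proof. by move=> v; have [+ _] := sigma_cvgP v (nbhs_filter v); exact. Qed.

Lemma sigma_add_continuous : continuous (fun x : W * W => x.1 + x.2).
Proof.
move=> x; apply/sigma_cvgP => i.
suff : F i y.1 + F i y.2 @[y --> x] --> F i x.1 + F i x.2.
  by rewrite -linearD; under eq_fun do rewrite -linearD.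
apply: cvgD.
  apply: (@continuous_comp (W * W)%type W R fst (F i)); first exact: cvg_fst.
  exact: sigma_eval_continuous.
apply: (@continuous_comp (W * W)%type W R snd (F i)); first exact: cvg_snd.
exact: sigma_eval_continuous.
Qed.

Lemma sigma_scale_continuous : continuous (fun z : R^o * W => z.1 *: z.2).
Proof.
move=> z; apply/sigma_cvgP => i.
suff : y.1 * F i y.2 @[y --> z] --> z.1 * F i z.2.
  by rewrite -[_ * _]linearZ; under eq_fun do rewrite -[_ * _]linearZ.
apply: cvgM; first exact: (@cvg_fst _ _ (nbhs z.1) (nbhs z.2) _).
apply: (@continuous_comp (R^o * W)%type W R snd (F i)); first exact: cvg_snd.
exact: sigma_eval_continuous.
Qed.

Lemma sigma_locally_convex : exists2 B : set_system W,
  (forall b, b \in B -> convex_set b) & basis B.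
Proof.
exists [set b | open b /\ convex_set b]; first by move=> b /[!inE] -[].
split=> [b []//|x].
have FF : Filter (filter_from
    [set U : set W | [set b | open b /\ convex_set b] U /\ U x] id).
  apply: filter_from_filter.
    exists setT; split=> //; split; first exact: openT.
    by move=> ? ? ? _ _; rewrite inE.
  move=> A B [[oA cA] Ax] [[oB cB] Bx]; exists (A `&` B) => //.
  split=> //; split; first exact: openI.
  move=> u v l /[!inE] -[Au Bu] [Av Bv].
  by split; apply/set_mem; [apply: cA|apply: cB]; exact/mem_set.
apply/sigma_cvgP => i; apply/cvgrPdist_lt => e e0.
exists ((F i : W -> R) @^-1` ball (F i x) e) => //; split; last exact: ballxx.
split.
  apply: open_comp; last exact: ball_open.
  by move=> y _; exact: sigma_eval_continuous.
apply/convex_setW => u v; rewrite !inE -!ball_normE/= => Fu Fv l l0 l1.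
rewrite inE/=.
have -> : F i (@conv R (convex_lmodType W) l u v) =
    l%:num * F i u + (1 - l%:num) * F i v.
  by rewrite [LHS](linearD (F i)) !linearZ.
have -> : F i x - (l%:num * F i u + (1 - l%:num) * F i v) =
    l%:num * (F i x - F i u) + (1 - l%:num) * (F i x - F i v).
  by ring.
rewrite (le_lt_trans (ler_normD _ _))// !normrM.
rewrite (ger0_norm (ltW l0)) (@ger0_norm _ (1 - _)) ?subr_ge0 ?ltW//.
rewrite [ltRHS](_ : _ = l%:num * e + (1 - l%:num) * e); last by ring.
by apply: ltrD; rewrite ltr_pM2l ?subr_gt0.
Qed.

HB.instance Definition _ := PreTopologicalLmod_isTvs.Build R W
  sigma_add_continuous sigma_scale_continuous sigma_locally_convex.
(* The factory above only installs the uniform structure. *)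
HB.instance Definition _ :=
  PreTopologicalNmodule_isTopologicalNmodule.Build W sigma_add_continuous.
HB.instance Definition _ :=
  TopologicalNmodule_isTopologicalLmodule.Build R W sigma_scale_continuous.
HB.instance Definition _ := Uniform_isTvs.Build R W sigma_locally_convex.
End SigmaTopology.

Section Dual.
Context (R : realType) (E : tvsType R).

Definition dual_pred : {pred E -> R} :=
  [pred f : E -> R | `[< linear f /\ continuous f >]].

Lemma dual_predP (f : E -> R) :
  reflect (linear f /\ continuous f) (f \in dual_pred).
Proof. exact: asboolP. Qed.

Record dual := Dual { dual_fun :> E -> R ; _ : dual_fun \in dual_pred }.

HB.instance Definition _ := [isSub for dual_fun].
HB.instance Definition _ := [Choice of dual by <:].

Lemma dual_submod_closed : submod_closed dual_pred.
Proof.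
split=> [|a f g /dual_predP[lf cf] /dual_predP[lg cg]]; apply/dual_predP.
  split=> [b u v|x]; last exact: cvg_cst.
  by rewrite [RHS]addr0 [RHS]mulr0.
split=> [b u v|x].
  change (a * f (b *: u + v) + g (b *: u + v) =
    b * (a * f u + g u) + (a * f v + g v)).
  by rewrite lf lg -![_ *: _]/(_ * _); ring.
apply: cvgD; last exact: cg.
by apply: cvgZr; exact: cf.
Qed.

HB.instance Definition _ := GRing.isSubmodClosed.Build R (E -> R) dual_pred
  (GRing.submod_closed_semi dual_submod_closed).
HB.instance Definition _ := [SubChoice_isSubLmodule of dual by <:].

Lemma dual_linear (phi : dual) : linear phi.
Proof. by case: phi => f /= /dual_predP[]. Qed.

HB.instance Definition _ (phi : dual) :=
  GRing.isLinear.Build R E R *:%R phi (dual_linear phi).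

Lemma dual_continuous (phi : dual) : continuous phi.
Proof. by case: phi => f /= /dual_predP[]. Qed.

Definition dual_eval (x : E) (phi : dual) : R := phi x.

Lemma dual_eval_linear x : linear (dual_eval x).
Proof. by []. Qed.

HB.instance Definition _ x :=
  GRing.isLinear.Build R dual R *:%R (dual_eval x) (dual_eval_linear x).

Definition weak := sigma_topology (fun phi : dual => phi : {linear E -> R}).

HB.instance Definition _ := Tvs.on weak.

Definition weak_star :=
  sigma_topology (fun x => dual_eval x : {linear dual -> R}).

HB.instance Definition _ := Tvs.on weak_star.

End Dual.

Section Cp.
Context (R : realType) (K : topologicalType).
Local Notation CK := (continuousType K R).
Implicit Types f g : CK.

Lemma cts_addP f g : continuous (fun x => f x + g x).
Proof. by move=> x; apply: cvgD; apply: cts_fun. Qed.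

Lemma cts_oppP f : continuous (fun x => - f x).
Proof. by move=> x; apply: cvgN; apply: cts_fun. Qed.

Lemma cts_scaleP (a : R) f : continuous (fun x => a *: f x).
Proof. by move=> x; apply: cvgZr; apply: cts_fun. Qed.

Definition cts_zero : CK := cst 0.
Definition cts_opp f : CK := mkcts (@cts_oppP f).
Definition cts_add f g : CK := mkcts (@cts_addP f g).
Definition cts_scale (a : R) f : CK := mkcts (@cts_scaleP a f).

Lemma cts_addA : associative cts_add.
Proof. by move=> f g h; apply/continuousEP => x; exact: addrA. Qed.

Lemma cts_addC : commutative cts_add.
Proof. by move=> f g; apply/continuousEP => x; exact: addrC. Qed.

Lemma cts_add0 : left_id cts_zero cts_add.
Proof. by move=> f; apply/continuousEP => x; exact: add0r. Qed.

Lemma cts_addN : left_inverse cts_zero cts_opp cts_add.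
Proof. by move=> f; apply/continuousEP => x; exact: addNr. Qed.

HB.instance Definition _ :=
  GRing.isZmodule.Build CK cts_addA cts_addC cts_add0 cts_addN.

Lemma cts_scaleA a b f : cts_scale a (cts_scale b f) = cts_scale (a * b) f.
Proof. by apply/continuousEP => x; exact: scalerA. Qed.

Lemma cts_scale1 : left_id 1 cts_scale.
Proof. by move=> f; apply/continuousEP => x; exact: scale1r. Qed.

Lemma cts_scaleDr : right_distributive cts_scale +%R.
Proof. by move=> a f g; apply/continuousEP => x; exact: scalerDr. Qed.

Lemma cts_scaleDl f : {morph cts_scale^~ f : a b / a + b}.
Proof. by move=> a b; apply/continuousEP => x; exact: scalerDl. Qed.

HB.instance Definition _ := GRing.Zmodule_isLmodule.Build R CK
  cts_scaleA cts_scale1 cts_scaleDr cts_scaleDl.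

Definition cts_eval (x : K) (f : CK) : R := f x.

Lemma cts_eval_linear x : linear (cts_eval x).
Proof. by []. Qed.

HB.instance Definition _ x :=
  GRing.isLinear.Build R CK R *:%R (cts_eval x) (cts_eval_linear x).

Definition C_p := sigma_topology (fun x => cts_eval x : {linear CK -> R}).

HB.instance Definition _ := Tvs.on C_p.

End Cp.

Section LinearNotions.
Context (R : realType).

(* T is a linear homeomorphism of H onto the subset G of L; only the values on
   G of the inverse S matter. *)
Definition linear_homeomorphism (H L : tvsType R) (G : set L)
    (T : {linear H -> L}) :=
  [/\ set_bij setT G T, continuous T &
      exists2 S : L -> H, cancel T S & {within G, continuous S}].

(* Spaces are assumed Tychonoff, which for compact spaces means Hausdorff. *)
Definition linearly_Eberlein_Grothendieck (H : tvsType R) :=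
  exists K : topologicalType,
    [/\ compact [set: K], hausdorff_space K &
        exists2 G : set (C_p R K), submod_closed (mem G) &
          exists T : {linear H -> C_p R K}, linear_homeomorphism G T].

Definition linear_span (L : lmodType R) (A : set L) : set L :=
  smallest [set G : set L | submod_closed (mem G)] A.

Definition compactly_generated (L : topologicalLmodType R) :=
  exists2 K : set L, compact K & linear_span K = setT.

End LinearNotions.

(* Main.v *)
Require Import Defs.
From HB Require Import structures.
From mathcomp Require Import all_boot all_order all_algebra.
From mathcomp Require Import all_classical all_reals all_analysis.
From mathcomp Require Import ring lra.

(** Points of a compact space and functionals on E exchange roles.

    If T embeds (E, w) linearly into C_p(K), each point k of K gives the
    functional x |-> T x k, which is weakly continuous, hence lies in E^*.  As
    T x is continuous on K, this is a continuous map from K to (E^*, w^* ), so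
    its image is w^*-compact.  The image spans E^*: since the inverse of T is
    continuous for pointwise convergence, every phi in E^* is bounded by 1 on
    the points x for which T x vanishes on a suitable finite subset of K.
    Such points form a linear subspace, so phi vanishes there, and a functional
    that vanishes on the common kernel of finitely many others is a linear
    combination of them ([mem_submod_kernel]).

    Conversely, if a w^*-compact set A spans E^*, evaluation x |-> (phi |->
    phi x) maps E linearly into C_p(A).  Each property that is needed of this
    map concerns one functional at a time, holds for the functionals in A, and
    is stable under linear combinations; since A spans E^*, it holds for all of
    E^*.  In this way the values on A determine phi x for every phi, and the
    inverse map is weakly continuous.  Injectivity then reduces to the fact
    that E^* separates the points of E ([dual_separates]).

    That fact is where local convexity and the Hausdorff hypothesis enter.  It
    follows from the Hahn-Banach theorem applied to the gauge of a convex
    neighbourhood of 0.  The Hahn-Banach theorem is obtained here without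
    extending partially defined functionals: by Zorn's lemma there is a
    minimal sublinear functional below a given one, and a minimal sublinear
    functional is linear ([hahn_banach]). *)

Set Implicit Arguments.
Unset Strict Implicit.
Unset Printing Implicit Defensive.

Import Order.TTheory GRing.Theory Num.Theory.
Import numFieldNormedType.Exports.

Local Open Scope classical_set_scope.
Local Open Scope ring_scope.

(** * The Hahn-Banach theorem for sublinear functionals *)

Section HahnBanach.
Context (R : realType) (V : lmodType R).
Implicit Types p q : V -> R.

(** Positive homogeneity is stated as an inequality, which is all that has to
    be checked on examples; applying it to a and to a^-1 gives the equality. *)
Definition sublinear p :=
  (forall x y, p (x + y) <= p x + p y) /\
  (forall a x, 0 < a -> p (a *: x) <= a * p x).

Lemma sublinearZ p a x : sublinear p -> 0 < a -> p (a *: x) = a * p x.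
Proof.
move=> [_ pZ] a0; apply/eqP; rewrite eq_le pZ//=.
rewrite -ler_pdivlMl// -[leLHS](congr1 p (scalerK (lt0r_neq0 a0) x)).
by rewrite pZ ?invr_gt0.
Qed.

Lemma sublinear0 p : sublinear p -> p 0 = 0.
Proof.
move=> sp; have := sublinearZ (a := 2) 0 sp.
by rewrite scaler0 => /(_ (ltr0n _ 2)); lra.
Qed.

Lemma sublinear_oppr_ge p x : sublinear p -> - p (- x) <= p x.
Proof.
by move=> sp; have := sp.1 x (- x); rewrite subrr sublinear0// addrC lerNl; lra.
Qed.

(** An infimum of functions inherits the two inequalities even when they fail
    for the individual functions, as long as each can be realized by moving
    within the family.  Both the infimum of a chain and the one that defines
    the tilt below are of this kind. *)
Lemma sublinear_inf (D : set (V -> R)) : D !=set0 ->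
  (forall x, has_lbound [set g x | g in D]) ->
  (forall g h x y, D g -> D h ->
    exists2 k, D k & k (x + y) <= g x + h y) ->
  (forall g a x, D g -> 0 < a -> exists2 k, D k & k (a *: x) <= a * g x) ->
  sublinear (fun x => inf [set g x | g in D]).
Proof.
move=> [g0 Dg0] Dlb DD DZ.
have infD k x : D k -> inf [set g x | g in D] <= k x.
  by move=> Dk; apply: ge_inf => //; exists k.
have D0 x : [set g x | g in D] !=set0 by exists (g0 x), g0.
split=> [x y|a x a0].
  rewrite -lerBlDr; apply: lb_le_inf => // _ [g Dg <-].
  rewrite lerBlDr -lerBlDl; apply: lb_le_inf => // _ [h Dh <-].
  have [k Dk] := DD _ _ x y Dg Dh; rewrite lerBlDl; apply: le_trans.
  exact: infD.
rewrite -ler_pdivrMl//; apply: lb_le_inf => // _ [g Dg <-].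
rewrite ler_pdivrMl//; have [k Dk] := DZ _ _ x Dg a0.
by apply: le_trans; exact: infD.
Qed.

(** The functional is q x = inf_(t >= 0) (p (x + t y) - t p y), with the two
    bounds given by t = 0 and t = 1.  For a minimal p the second one forces
    p x + p y <= p (x + y), that is, additivity. *)
Lemma sublinear_tilt p y : sublinear p ->
  exists q, [/\ sublinear q, forall x, q x <= p x &
                forall x, q x <= p (x + y) - p y].
Proof.
move=> sp; have [pD _] := sp.
pose g t x := p (x + t *: y) - t * p y.
have gZ t : 0 <= t -> p (t *: y) = t * p y.
  rewrite le_eqVlt => /predU1P[<-|/sublinearZ->//].
  by rewrite scale0r mul0r sublinear0.
pose D := [set g t | t in [set t : R | 0 <= t]].
have Dlb x : has_lbound [set h x | h in D].
  exists (- p (- x)) => _ [_ [t t0 <-] <-]; rewrite /g.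
  by have := pD (x + t *: y) (- x); rewrite addrC addKr gZ//; lra.
have Dinf t x : 0 <= t -> inf [set h x | h in D] <= g t x.
  by move=> t0; apply: ge_inf => //; exists (g t) => //; exists t.
exists (fun x => inf [set h x | h in D]); split=> [|x|x].
- apply: sublinear_inf => //.
  + by exists (g 0), 0 => /=.
  + move=> _ _ x z [s s0 <-] [t t0 <-]; exists (g (s + t)).
      by exists (s + t) => //=; exact: addr_ge0.
    rewrite /g scalerDl addrACA.
    by have := pD (x + s *: y) (z + t *: y); lra.
  + move=> _ a x [t t0 <-] a0; exists (g (a * t)).
      by exists (a * t) => //=; rewrite mulr_ge0// ltW.
    by rewrite /g -scalerA -scalerDr sublinearZ//; lra.
- by have := Dinf 0 x (lexx _); rewrite /g scale0r addr0 mul0r subr0.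
- by have := Dinf 1 x ler01; rewrite /g scale1r mul1r.
Qed.

(** Chains have a lower bound because every sublinear q <= p satisfies
    - p (- x) <= - q (- x) <= q x, so that their pointwise infimum is finite. *)
Lemma minimal_sublinear p : sublinear p ->
  exists q, [/\ sublinear q, forall x, q x <= p x & forall q', sublinear q' ->
    (forall x, q' x <= q x) -> q' = q].
Proof.
move=> sp; pose S := {q : V -> R | sublinear q /\ forall x, q x <= p x}.
pose below (q r : S) := `[< forall x, sval r x <= sval q x >].
have [||A Atot|[q [sq qp]] qmin] :=
    @ZL_preorder S (exist _ p (conj sp (fun=> lexx _))) below.
- by move=> q; apply/asboolP.
- move=> q r s /asboolP qr /asboolP rs; apply/asboolP => x.
  exact: le_trans (rs x) (qr x).
- have [A0|/set0P[[q0 [sq0 q0p]] Aq0]] := eqVneq A set0.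
    exists (exist _ p (conj sp (fun=> lexx _))) => q.
    by rewrite A0.
  pose D := [set sval q | q in A].
  have Dlb x : has_lbound [set g x | g in D].
    exists (- p (- x)) => _ [_ [[q [sq qp]] _ <-] <-] /=.
    by apply: le_trans (sublinear_oppr_ge _ sq); rewrite lerN2.
  have Dinf (q : S) x : A q -> inf [set g x | g in D] <= sval q x.
    by move=> Aq; apply: ge_inf => //; exists (sval q) => //; exists q.
  have sinf : sublinear (fun x => inf [set g x | g in D]).
    apply: sublinear_inf => //.
    + by exists q0; exists (exist _ q0 (conj sq0 q0p)).
    + move=> _ _ x y [q Aq <-] [r Ar <-].
      have [/asboolP qr|/asboolP rq] := Atot q r Aq Ar.
        exists (sval r); first by exists r.
        by apply: le_trans ((svalP r).1.1 x y) _; rewrite lerD2r.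
      exists (sval q); first by exists q.
      by apply: le_trans ((svalP q).1.1 x y) _; rewrite lerD2l.
    + move=> _ a x [q Aq <-] a0; exists (sval q); first by exists q.
      exact: (svalP q).1.2.
  have infp x : inf [set g x | g in D] <= p x.
    exact: le_trans (Dinf _ x Aq0) (q0p x).
  exists (exist _ _ (conj sinf infp) : S) => q Aq; apply/asboolP => x.
  exact: Dinf.
exists q; split=> // q' sq' q'q; apply/funext => x; apply/eqP.
rewrite eq_le q'q/=.
have q'p z : q' z <= p z by exact: le_trans (q'q z) (qp z).
have /asboolP := qmin (exist _ q' (conj sq' q'p) : S) (asboolT q'q).
by apply.
Qed.

(** Tilting p towards x0 before minimizing makes f (- x0) <= - p x0, which is
    what gives the value at x0 in addition to f <= p. *)
Lemma hahn_banach p x0 : sublinear p ->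
  exists f : {linear V -> R}, (forall x, f x <= p x) /\ f x0 = p x0.
Proof.
move=> sp; have [r [sr rp rx0]] := sublinear_tilt x0 sp.
have [q [sq qr qmin]] := minimal_sublinear sr.
have qD x y : q (x + y) = q x + q y.
  have [q' [sq' q'q q'y]] := sublinear_tilt y sq.
  have := q'y x; rewrite (qmin _ sq' q'q) => qxy.
  by apply/eqP; rewrite eq_le sq.1/=; lra.
have qN x : q (- x) = - q x.
  by have := qD x (- x); rewrite subrr sublinear0//; lra.
have qlin : linear q.
  move=> a x y; rewrite qD; congr (_ + _).
  have [a0|a0|->] := ltgtP a 0; last by rewrite !scale0r sublinear0.
    by rewrite -[a]opprK scaleNr qN sublinearZ ?oppr_gt0// scaleNr.
  exact: sublinearZ.
pose f : {linear V -> R} := HB.pack q (GRing.isLinear.Build _ _ _ _ q qlin).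
exists f; split=> [x|]; first by apply: le_trans (qr x) (rp x).
change (q x0 = p x0); apply/eqP; rewrite eq_le (le_trans (qr _) (rp _))//=.
have := rx0 (- x0); rewrite addNr sublinear0// sub0r => h.
by have := le_trans (qr _) h; rewrite qN lerN2.
Qed.

End HahnBanach.

(** * Separation of points by continuous functionals *)

Section Separation.
Context (R : realType) (E : tvsType R).
Implicit Type U : set E.

Lemma nbhs0_scaled_sub U (a : R) (x : E) : nbhs 0 U ->
  \forall y \near x, U (a *: (x - y)).
Proof.
move=> U0.
suff : a *: (x - y) @[y --> x] --> (0 : E) by apply.
rewrite -(scaler0 _ a) -(subrr x).
apply: (@continuous_comp E (R^o * E)%type E (fun y => (a, x - y))
  (fun z => z.1 *: z.2)); last exact: scale_continuous.
apply: (@cvg_pair _ _ _ _ (nbhs (a : R^o))); first exact: cvg_cst.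
apply: (@continuous_comp E (E * E)%type E (fun y => (x, y))
  (fun z => z.1 - z.2)); last exact: sub_continuous.
by apply: cvg_pair; [exact: cvg_cst|exact: cvg_id].
Qed.

Lemma nbhs0_absorbing U (x : E) : nbhs 0 U ->
  exists2 t : R, 0 < t & U (t^-1 *: x).
Proof.
move=> U0; have : t *: x @[t --> (0 : R^o)] --> (0 : E).
  rewrite -(scale0r x).
  apply: (@continuous_comp R^o (R^o * E)%type E (fun t => (t, x))
    (fun z => z.1 *: z.2)); last exact: scale_continuous.
  apply: (@cvg_pair _ _ _ _ (nbhs (0 : R^o))); first exact: cvg_id.
  exact: cvg_cst.
move=> /(_ U U0) /nbhs_ballP[e/= e0 eU].
exists (e / 2)^-1; first by rewrite invr_gt0 divr_gt0.
rewrite invrK; apply: eU; rewrite -ball_normE/= sub0r normrN.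
by rewrite gtr0_norm ?divr_gt0// ltr_pdivrMr// ltr_pMr// ltr1n.
Qed.

(** A one-sided bound suffices: near x both (x - y) / e and its opposite lie
    in U. *)
Lemma linear_bounded_above_continuous U (f : {linear E -> R}) : nbhs 0 U ->
  (forall x, U x -> f x <= 1) -> continuous f.
Proof.
move=> U0 fU x; apply/cvgrPdist_le => e e0.
near=> y.
have /fU : U (e^-1 *: (x - y)) by near: y; exact: nbhs0_scaled_sub.
have /fU : U (- e^-1 *: (x - y)) by near: y; exact: nbhs0_scaled_sub.
rewrite !linearZ/= linearB/= -![_ *: _]/(_ * _) => h1 h2.
rewrite -(mulr1 e) -ler_pdivrMl// -[e^-1]gtr0_norm ?invr_gt0// -normrM.
by rewrite ler_norml; apply/andP; split; lra.
Unshelve. all: by end_near. Qed.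

Definition gauge U (x : E) : R := inf [set t | 0 < t /\ U (t^-1 *: x)].

Lemma gauge_le U (x : E) (t : R) : 0 < t -> U (t^-1 *: x) -> gauge U x <= t.
Proof.
move=> t0 Ut; apply: ge_inf; last by split.
by exists 0 => s [/ltW].
Qed.

(** Convexity with unnormalized weights, the form in which the gauge is seen
    to be subadditive. *)
Lemma convex_set_mean U (x y : E) (a b : R) : convex_set U -> U x -> U y ->
  0 < a -> 0 < b -> U ((a + b)^-1 *: (a *: x + b *: y)).
Proof.
move=> /convex_setW cU Ux Uy a0 b0; have ab0 : 0 < a + b by exact: addr_gt0.
have l0 : 0 < a / (a + b) by exact: divr_gt0.
have l1 : a / (a + b) < 1 by rewrite ltr_pdivrMr// mul1r ltrDl.
have -> : (a + b)^-1 *: (a *: x + b *: y) =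
    a / (a + b) *: x + (1 - a / (a + b)) *: y.
  have -> : 1 - a / (a + b) = b / (a + b) by field; rewrite gt_eqF.
  by rewrite scalerDr !scalerA ![(a + b)^-1 * _]mulrC.
apply/set_mem.
exact: (cU x y (mem_set Ux) (mem_set Uy) (Itv01 (ltW l0) (ltW l1)) l0 l1).
Qed.

Lemma gauge_sublinear U : convex_set U -> nbhs 0 U -> sublinear (gauge U).
Proof.
move=> cU U0.
have gauge_ex x : [set t : R | 0 < t /\ U (t^-1 *: x)] !=set0.
  by have [t] := nbhs0_absorbing x U0; exists t.
split=> [x y|a x a0].
  rewrite -lerBlDr; apply: lb_le_inf => // s [s0 Us].
  rewrite lerBlDr -lerBlDl; apply: lb_le_inf => // t [t0 Ut].
  rewrite lerBlDl; apply: gauge_le; first exact: addr_gt0.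
  have := convex_set_mean cU Us Ut s0 t0.
  by rewrite !scalerA !divff ?gt_eqF// !scale1r.
rewrite -ler_pdivrMl//; apply: lb_le_inf => // t [t0 Ut].
rewrite ler_pdivrMl//; apply: gauge_le; first exact: mulr_gt0.
by rewrite scalerA invfM mulrAC mulVf ?gt_eqF// mul1r.
Qed.

Lemma gauge_ge1 U (x : E) : convex_set U -> nbhs 0 U -> ~ U x -> 1 <= gauge U x.
Proof.
move=> cU U0 Ux; apply: lb_le_inf.
  by have [t] := nbhs0_absorbing x U0; exists t.
move=> t [t0 Ut]; rewrite leNgt; apply/negP => t1; apply: Ux.
have := convex_set_mean cU Ut (nbhs_singleton U0) t0 (_ : 0 < 1 - t).
rewrite subr_gt0 => /(_ t1).
by rewrite subrKC invr1 scale1r scaler0 addr0 scalerA divff ?gt_eqF// scale1r.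
Qed.

(** A convex neighbourhood of 0 that misses x has a gauge with value at least 1
    at x; a linear functional below the gauge with the same value at x is
    continuous because the gauge is at most 1 on the neighbourhood. *)
Lemma dual_separates (x : E) : hausdorff_space E ->
  (forall phi : dual E, phi x = 0) -> x = 0.
Proof.
move=> hE phix; apply: contrapT => /eqP x0.
have : nbhs (0 : E) (~` [set x]).
  apply: open_nbhs_nbhs; split; last by move=> /= x0'; rewrite -x0' eqxx in x0.
  apply: closed_openC; apply: accessible_closed_set1.
  exact: hausdorff_accessible.
have [B Bconvex [Bopen Bnbhs]] := @locally_convex R E.
move=> /Bnbhs[U [BU U0] Ux].
have cU : convex_set U by exact/Bconvex/mem_set.
have nU : nbhs 0 U by apply: open_nbhs_nbhs; split=> //; exact: Bopen.
have [f [fle fx]] := hahn_banach x (gauge_sublinear cU nU).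
have fc : continuous f.
  apply: (linear_bounded_above_continuous nU) => y Uy.
  apply: le_trans (fle y) _.
  by apply: gauge_le; rewrite ?invr1 ?scale1r.
have fP : (f : E -> R) \in @dual_pred R E.
  by apply/dual_predP; split=> //; exact: linearP.
have := gauge_ge1 cU nU (fun Uxx => Ux _ Uxx erefl).
by rewrite -fx [f x](phix (Dual fP)) ler10.
Qed.

End Separation.

(** * Common kernels and linear spans *)

Section Span.
Context (R : realType) (E : tvsType R).

(** A functional that vanishes on a finite intersection of kernels is a linear
    combination of the functionals involved.  If the first one, f, does not
    already vanish on the common kernel of the others, some z in that kernel
    has f z <> 0, and subtracting the right multiple of f from phi yields a
    functional that vanishes on that kernel. *)
Lemma mem_submod_kernel (G : set (dual E)) (s : seq (dual E)) (phi : dual E) :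
  submod_closed (mem G) -> {in s, forall f, G f} ->
  (forall x, {in s, forall f : dual E, f x = 0} -> phi x = 0) -> G phi.
Proof.
move=> [/set_mem G0 Glin]; have GD a f g : G f -> G g -> G (a *: f + g).
  by move=> Gf Gg; apply/set_mem/Glin; exact/mem_set.
elim: s phi => [|f s IH] phi Gs phis.
  suff -> : phi = 0 by [].
  by apply/val_inj/funext => x; exact: phis.
have {}IH := IH _ (fun g sg => Gs g (mem_behead (s := f :: s) sg)).
have [fs|] := pselect (forall x, {in s, forall g : dual E, g x = 0} -> f x = 0).
  apply: IH => x sx; apply: phis => g; rewrite inE => /predU1P[->|/sx//].
  exact: fs.
move=> /existsNP[z /not_implyP[sz /eqP fz]].
suff : G (phi - (phi z / f z) *: f).
  move=> Gphi; have := GD (phi z / f z) f _ (Gs f (mem_head _ _)) Gphi.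
  by rewrite addrC subrK.
apply: IH => x sx.
change (phi x - phi z / f z * f x = 0).
have : phi (x - (f x / f z) *: z) = 0.
  apply: phis => g; rewrite inE => /predU1P[->|sg]; rewrite linearB linearZ/=.
    by rewrite -[_ *: _]/(_ * _) divfK// subrr.
  by rewrite (sx _ sg) (sz _ sg) scaler0 subrr.
by rewrite linearB linearZ/= -[_ *: _]/(_ * _) => <-; ring.
Qed.

End Span.

(** * Topological preliminaries *)

Section Topology.
Context (R : realType).

Lemma hausdorff_separated (T : topologicalType) :
  (forall p q : T, (forall f : T -> R, continuous f -> f p = f q) -> p = q) ->
  hausdorff_space T.
Proof.
move=> sepT p q pq; apply: sepT => f fc; apply: (@Rhausdorff R) => A B Afp Bfq.
by have [x [Ax Bx]] := pq _ _ (fc p A Afp) (fc q B Bfq); exists (f x).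
Qed.

Lemma compact_set_type (T : topologicalType) (A : set T) :
  compact A -> compact [set: A].
Proof.
move=> Aco F FF _; pose G := (set_val : A -> T) @ F.
have GA : G A by apply: (@nearW A F) => -[x xA]; exact/set_mem.
have [x [Ax Gx]] := Aco G _ GA.
exists (SigSub (mem_set Ax)); split=> // B C FB [_ [[D oD <-] Dx] DC].
have : nbhs x D by exact: open_nbhs_nbhs.
have GB : G (set_val @` B) by apply: (@filterS A F _ B) => // y By; exists y.
by move=> /(Gx _ _ GB)[_ [[y By <-] Dy]]; exists y; split=> //; exact: DC.
Qed.

Lemma weak_continuous_id (E : tvsType R) : continuous (id : E -> weak E).
Proof. by move=> x; apply/sigma_cvgP => phi; exact: dual_continuous. Qed.

End Topology.

(** * Compactly generated weak-star duals *)

Section Characterization.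
Context (R : realType) (E : tvsType R).

(** That phi depends on finitely many points of K is read off from a filter:
    the sets of all x with T x = 0 at finitely many given points generate a
    filter F such that T x tends to 0 in C_p(K) along F.  Applying the inverse
    of T, the filter F itself converges to 0 in (E, w), so one of these sets
    lies in the strip |phi| < 1. *)
Lemma Eberlein_Grothendieck_compactly_generated :
  linearly_Eberlein_Grothendieck (weak E) -> compactly_generated (weak_star E).
Proof.
move=> [K [Kco _ [G Gsub [T [[Tfun Tinj Tsurj] Tc [S TK Sc]]]]]].
have ev_lin k : linear (fun x : E => cts_eval k (T x)).
  by move=> a x y; rewrite linearP.
have ev_cts k : continuous (fun x : E => cts_eval k (T x)).
  move=> x; apply: (@continuous_comp E (C_p R K) R (T : E -> _) (cts_eval k)).
    apply: (@continuous_comp E (weak E) (C_p R K) id T); last exact: Tc.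
    exact: weak_continuous_id.
  exact: (@sigma_eval_continuous _ _ _ (fun k => cts_eval k : {linear _ -> _})).
have ev_dual k : (fun x : E => cts_eval k (T x)) \in @dual_pred R E.
  exact/dual_predP.
pose ev k : weak_star E := Dual (ev_dual k).
exists [set ev k | k in [set: K]].
  apply: continuous_compact => //; apply: continuous_subspaceT => k.
  apply/sigma_cvgP => x.
  exact: (@cts_fun _ _ (T x : continuousType K R)).
apply/seteqP; split=> // phi _ H [Hsub AH].
pose N (s : seq K) := [set x : weak E | {in s, forall k, cts_eval k (T x) = 0}].
pose F := filter_from setT N.
have FF : Filter F.
  apply: filter_from_filter; first by exists [::].
  move=> s t _ _; exists (s ++ t) => // x Nx.
  by split=> k ks; apply: Nx; rewrite mem_cat ks ?orbT.
(* Each evaluation of T is eventually equal to 0 along F. *)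
have TF : T @ F --> (0 : C_p R K).
  apply/sigma_cvgP => k; rewrite linear0; apply: cvg_near_cst.
  exists [:: k] => // x /(_ k); apply; exact: mem_head.
have SF : F --> (0 : weak E).
  have GT x : G (T x) by exact: Tfun.
  have S0 : S 0 = 0 by rewrite -(linear0 T) TK.
  move=> A; rewrite -S0.
  move=> /((subspace_continuousP _ _).1 Sc _ (set_mem Gsub.1)) /TF.
  by apply: (@filterS _ F FF) => x /(_ (GT x)); rewrite /from_subspace /= TK.
have [] : F [set x | ball (phi 0) 1 (phi x)].
  have /sigma_cvgP/(_ phi) := SF; apply; exact: nbhsx_ballx.
move=> s _ Ns.
apply: (@mem_submod_kernel _ _ H [seq ev k | k <- s]) => //.
  by move=> _ /mapP[k _ ->]; apply: AH; exists k.
move=> x sx; apply: contrapT => /eqP phix.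
(* N s is closed under scaling, so a nonzero value of phi on it can be
   rescaled to 1. *)
have phix1 : phi ((phi x)^-1 *: x) = 1 by rewrite linearZ; exact: mulVf.
have := Ns ((phi x)^-1 *: x).
rewrite -ball_normE/= phix1 (linear0 phi) sub0r normrN normr1 ltxx => Nx.
suff /Nx : N s ((phi x)^-1 *: x) by [].
move=> k ks; rewrite linearZ linearZ/=.
have -> : cts_eval k (T x) = 0 by apply: (sx (ev k)); apply/mapP; exists k.
exact: mulr0.
Qed.

(** The compact space is the spanning set A itself; span_ind below is the
    principle that a linear condition on functionals need only be checked
    on A. *)
Lemma compactly_generated_Eberlein_Grothendieck :
  hausdorff_space E ->
  compactly_generated (weak_star E) -> linearly_Eberlein_Grothendieck (weak E).
Proof.
move=> hE [A Aco Aspan].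
have span_ind (H : set (weak_star E)) :
    submod_closed (mem H) -> A `<=` H -> forall phi, H phi.
  move=> Hsub AH phi; have : [set: weak_star E] phi by [].
  by rewrite -Aspan; apply.
have T_cts (x : E) : continuous (fun k : A => dual_eval x (val k)).
  move=> k; apply: (@continuous_comp A (weak_star E) R val (dual_eval x)).
    exact: initial_continuous.
  exact: (@sigma_eval_continuous _ _ _ (fun x => dual_eval x : {linear _ -> _})).
exists A; split.
- exact: compact_set_type.
- apply: (@hausdorff_separated R) => p q pq; apply/val_inj/val_inj/funext => x.
  exact: pq (T_cts x).
pose Tfun (x : weak E) : C_p R A := mkcts (T_cts x).
have Tlin : linear Tfun.
  move=> a x y; apply/continuousEP => k; exact: (dual_linear (val k)).
pose T : {linear weak E -> C_p R A} :=
  HB.pack Tfun (GRing.isLinear.Build _ _ _ _ Tfun Tlin).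
have TE (x : E) (phi : weak_star E) (Aphi : A phi) :
  cts_eval (SigSub (mem_set Aphi) : A) (T x) = phi x by [].
have Tinj : injective T.
  move=> x y Txy; apply/eqP; rewrite -subr_eq0; apply/eqP.
  apply: (@dual_separates R E) => // phi; rewrite (linearB phi); apply/eqP.
  rewrite subr_eq0; apply/eqP; move: phi.
  apply: (span_ind [set phi | phi x = phi y]) => [|phi Aphi].
    split; first exact/mem_set.
    move=> a f g /set_mem fxy /set_mem gxy; apply/mem_set.
    by change (a * f x + g x = a * f y + g y); rewrite fxy gxy.
  by rewrite /= -!(TE _ _ Aphi) Txy.
exists (range T).
  split; first by apply/mem_set; exists 0 => //; exact: linear0.
  move=> a _ _ /set_mem[x _ <-] /set_mem[y _ <-]; apply/mem_set.
  by exists (a *: x + y) => //; exact: linearP.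
exists T; split.
- split; [by move=> x _; exists x|by move=> x y _ _; exact: Tinj|by []].
- move=> x; have Fx : Filter (T @ nbhs x) by exact: fmap_filter.
  apply/sigma_cvgP => k.
  exact: (@sigma_eval_continuous _ _ _
    (fun phi : dual E => phi : {linear E -> R}) (val k)).
pose S (g : C_p R A) : weak E := xget 0 (T @^-1` [set g]).
have ST : cancel T S.
  move=> x; apply: Tinj; rewrite /S.
  by case: xgetP => [y _ //|/(_ x)]; apply: contra_notP.
exists S => //; apply/subspace_continuousP => _ [x _ <-].
rewrite /from_subspace ST; apply/sigma_cvgP.
pose H : set (weak_star E) :=
  [set phi : dual E |
    phi (S g) @[g --> within (range T) (nbhs (T x))] --> phi x].
apply: (span_ind H) => [|phi Aphi].
  split; first by apply/mem_set; exact: cvg_cst.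
  move=> a f g /set_mem fx /set_mem gx; apply/mem_set.
  by apply: cvgD => //; exact: cvgZr.
pose k : A := SigSub (mem_set Aphi).
have : cts_eval k g @[g --> within (range T) (nbhs (T x))] --> cts_eval k (T x).
  apply: cvg_within_filter.
  exact: (@sigma_eval_continuous _ _ _ (fun k => cts_eval k : {linear _ -> _})).
apply: cvg_trans; apply: near_eq_cvg.
by apply: filterS (withinT _ _) => _ [y _ <-]; rewrite ST.
Qed.

End Characterization.

Theorem theorem3p2 (R : realType) (E : tvsType R) (hE : hausdorff_space E) :
  linearly_Eberlein_Grothendieck (weak E) <->
  compactly_generated (weak_star E).
Proof.
split; first exact: Eberlein_Grothendieck_compactly_generated.
exact: compactly_generated_Eberlein_Grothendieck.
Qed.
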